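(* For odd $p$, $$\sum_{n=1}^{\infty}\frac{(-1)^{n(p-1)/2}\sum_{k=1}^{(p-1)/2}(-1)^k L_{2kp^n}}{F_{p^{n+1}}} = \frac{1}{F_p}.$$
   Context: $F_n$ and $L_n$ denote the $n$-th Fibonacci and Lucas numbers: $F_n = \frac{\alpha^n-\beta^n}{\sqrt5}$ and $L_n=\alpha^n+\beta^n$, where $\alpha=\frac{1+\sqrt5}{2}$ and $\beta=\frac{1-\sqrt5}{2}$.
   Formalization: The claim is proved for odd integers p ≥ 3; p = 1 is excluded because the inner sum is then empty, so the left side is 0 while 1/F_1 = 1, and negative p is excluded because the range of k up to (p-1)/2 then has no meaning. *)

(* Defs.v *)
From mathcomp Require Import all_boot all_order all_algebra.
From mathcomp Require Import all_classical all_reals all_analysis.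

Set Implicit Arguments.
Unset Strict Implicit.
Unset Printing Implicit Defensive.

Import Order.TTheory GRing.Theory Num.Theory.
Local Open Scope ring_scope.

Definition alpha (R : realType) : R := (1 + Num.sqrt 5) / 2.

Definition beta (R : realType) : R := (1 - Num.sqrt 5) / 2.

(* F_n and L_n for n >= 0, as elements of R, by the Binet formulas. *)
Definition fib (R : realType) (n : nat) : R :=
  (alpha R ^+ n - beta R ^+ n) / Num.sqrt 5.

Definition lucas (R : realType) (n : nat) : R := alpha R ^+ n + beta R ^+ n.

(* Main.v *)
(* Put m = p^n and h = (p-1)/2. Since alpha^m beta^m = -1, dividing
   alpha^(pm) - beta^(pm) by alpha^m - beta^m and pairing conjugate terms gives
   F_(pm) / F_m = (-1)^h (1 + sum_(k=1)^h (-1)^k L_(2km)).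
   Hence the n-th summand is u_n - u_(n+1) with u_n = (-1)^((n+1)h) / F_(p^n),
   so the series telescopes to u_1 = 1 / F_p, as F_(p^n) tends to infinity. *)
Require Import Defs.
From mathcomp Require Import all_boot all_order all_algebra.
From mathcomp Require Import all_classical all_reals all_analysis.
From mathcomp Require Import ring lra.

Set Implicit Arguments.
Unset Strict Implicit.
Unset Printing Implicit Defensive.

Import Order.TTheory GRing.Theory Num.Theory.
Import numFieldNormedType.Exports.
Local Open Scope classical_set_scope.
Local Open Scope ring_scope.

(** Induction on [h] by [a^(n+2) - b^(n+2) = ab (a^n - b^n) + (a - b)(a^(n+1) + b^(n+1))] with
    [n = 2h+1]; the product form avoids dividing by [a - b]. *)
Lemma subX_odd_of_mulN1 (R : comPzRingType) (a b : R) (h : nat) :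
  a * b = -1 ->
  a ^+ h.*2.+1 - b ^+ h.*2.+1 =
  (a - b) * (-1) ^+ h *
    (1 + \sum_(1 <= k < h.+1) (-1) ^+ k * (a ^+ (2 * k) + b ^+ (2 * k))).
Proof.
move=> ab; elim: h => [|h IH]; first by rewrite big_geq // !expr1; ring.
have s1 : (-1 : R) ^+ h * (-1) ^+ h = 1 by rewrite -expr2 sqrr_sign.
rewrite big_nat_recr //= mul2n addrA mulrDr.
have -> : (a - b) * (-1) ^+ h.+1 *
    (1 + \sum_(1 <= k < h.+1) (-1) ^+ k * (a ^+ (2 * k) + b ^+ (2 * k))) =
    a * b * (a ^+ h.*2.+1 - b ^+ h.*2.+1) by rewrite IH ab exprS; ring.
rewrite doubleS !exprS.
set s := (-1) ^+ h in s1 *; set x := a ^+ _; set y := b ^+ _.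
transitivity (a * b * (a * x - b * y) + s * s * (a - b) * (a * (a * x) + b * (b * y))).
  by rewrite s1; ring.
ring.
Qed.

Section FibonacciOdd.
Variable R : realType.

Lemma sqrt5_gt1 : 1 < Num.sqrt (5 : R).
Proof. by rewrite -[X in X < _]sqrtr1 ltr_sqrt; lra. Qed.

Lemma alpha_gt1 : 1 < alpha R.
Proof. by rewrite /alpha; have := sqrt5_gt1; lra. Qed.

Lemma alpha_beta : alpha R * beta R = -1.
Proof.
have : Num.sqrt (5 : R) ^+ 2 = 5 by rewrite sqr_sqrtr.
by rewrite /alpha /beta expr2; lra.
Qed.

Lemma beta_lt0 : beta R < 0.
Proof. by rewrite /beta; have := sqrt5_gt1; lra. Qed.

(** Since [beta] is negative, so are its odd powers, and the Binet numerator exceeds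
    [alpha ^+ m]. *)
Lemma fib_odd_ge (m : nat) : odd m -> alpha R ^+ m / Num.sqrt 5 <= fib R m.
Proof.
move=> m_odd; rewrite ler_pM2r; last first.
  by rewrite invr_gt0 (lt_trans ltr01 sqrt5_gt1).
by rewrite lerDl oppr_ge0 ltW // exprn_odd_lt0 // beta_lt0.
Qed.

Lemma fib_odd_gt0 (m : nat) : odd m -> 0 < fib R m.
Proof.
move=> /fib_odd_ge; apply: lt_le_trans.
by rewrite divr_gt0 ?exprn_gt0 // (lt_trans ltr01) ?sqrt5_gt1 ?alpha_gt1.
Qed.

(** The ring identity at [alpha ^+ m] and [beta ^+ m], whose product [(-1) ^+ m] is [-1] for odd
    [m]. *)
Lemma fib_mul_odd (m h : nat) : odd m ->
  fib R (m * h.*2.+1) =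
  fib R m * (-1) ^+ h *
    (1 + \sum_(1 <= k < h.+1) (-1) ^+ k * lucas R (2 * k * m)).
Proof.
move=> m_odd; rewrite /fib !exprM subX_odd_of_mulN1; last first.
  by rewrite -exprMn alpha_beta -signr_odd m_odd expr1.
under [in LHS]eq_bigr => k _ do rewrite -!exprM [(m * _)%N]mulnC.
rewrite /lucas; ring.
Qed.

(** The crude bound [n <= p ^ n] suffices: it puts the reciprocals below a geometric sequence of
    ratio [alpha^-1 < 1]. *)
Lemma invf_fib_cvg0 (p : nat) : (1 < p)%N -> odd p ->
  (fib R (p ^ n))^-1 @[n --> \oo] --> 0.
Proof.
move=> p_gt1 p_odd; have a1 := alpha_gt1; have a0 := lt_trans ltr01 a1.
have s0 : 0 < Num.sqrt (5 : R) := lt_trans ltr01 sqrt5_gt1.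
apply: (@squeeze_cvgr _ _ _ _ (fun=> 0) (fun n => Num.sqrt 5 * (alpha R)^-1 ^+ n)).
- near=> n; have odd_pn : odd (p ^ n) by rewrite oddX p_odd orbT.
  rewrite invr_ge0 ltW ?fib_odd_gt0 //=.
  rewrite exprVn -[leRHS]invrK lef_pV2 ?posrE ?fib_odd_gt0 //; last first.
    by rewrite invr_gt0 mulr_gt0 ?invr_gt0 ?exprn_gt0.
  apply: le_trans (fib_odd_ge odd_pn); rewrite invfM invrK mulrC.
  rewrite ler_pM2r ?invr_gt0 // ler_eXn2l // ltnW //; exact: ltn_expl.
- exact: cvg_cst.
- rewrite -[X in _ --> X](mulr0 (Num.sqrt 5)); apply: cvgMr.
  by apply: cvg_expr; rewrite ger0_norm ?invr_ge0 ?ltW // invf_lt1.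
Unshelve. all: by end_near. Qed.

End FibonacciOdd.

Theorem theorem8 (R : realType) (p : nat) (p_gt1 : (1 < p)%N) (p_odd : odd p) :
  (\sum_(1 <= n < N)
     ((-1) ^+ (n * ((p - 1) %/ 2)) *
        \sum_(1 <= k < ((p - 1) %/ 2).+1)
           (-1) ^+ k * lucas R (2 * k * p ^ n)) / fib R (p ^ n.+1))
    @[N --> \oo] --> 1 / fib R p.
Proof.
set h := ((p - 1) %/ 2)%N.
have ph : p = h.*2.+1.
  have pE : p./2.*2.+1 = p by rewrite -[RHS]odd_double_half p_odd.
  by rewrite /h subn1 divn2 -{2}pE /= doubleK pE.
have odd_pX n : odd (p ^ n) by rewrite oddX p_odd orbT.
pose u n : R := (-1) ^+ (n.+1 * h) / fib R (p ^ n).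
have term_telescopes n :
    ((-1) ^+ (n * h) * \sum_(1 <= k < h.+1) (-1) ^+ k * lucas R (2 * k * p ^ n))
      / fib R (p ^ n.+1) = - (u n.+1 - u n).
  rewrite /u; have F0 := lt0r_neq0 (fib_odd_gt0 R (odd_pX n)).
  (* Left in the goal so that the next rewrite factors it too; it then yields [1 + S != 0]. *)
  have := lt0r_neq0 (fib_odd_gt0 R (odd_pX n.+1)).
  rewrite (_ : p ^ n.+1 = p ^ n * h.*2.+1)%N ?fib_mul_odd // -?ph ?expnSr //.
  set S := \sum_(_ <= _ < _) _.
  have s1 : (-1 : R) ^+ h * (-1) ^+ h = 1 by rewrite -expr2 sqrr_sign.
  rewrite !mulSn !exprD !mulrA s1 mul1r.
  set e := (-1) ^+ h in s1 *; set F := fib R _ in F0 *; set g := (-1) ^+ (n * h).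
  rewrite !mulf_eq0 !negb_or => /andP[/andP[_ e0] S0].
  (* [field] does not know [e * e = 1]; with [e^-1] in place of [e] the identity holds for any
     nonzero [e]. *)
  have eV : e^-1 = e by rewrite -[LHS]mulr1 -s1 mulrA mulVf // mul1r.
  have -> : e * g = e^-1 * g by rewrite eV.
  by field; rewrite F0 e0 S0.
(* At [N = 0] the sum is empty, while [u 1 - u 0] is not zero. *)
have partial_sum N : (0 < N)%N ->
    \sum_(1 <= n < N)
      ((-1) ^+ (n * h) * \sum_(1 <= k < h.+1) (-1) ^+ k * lucas R (2 * k * p ^ n))
        / fib R (p ^ n.+1) = u 1%N - u N.
  move=> N_gt0; under eq_bigr => n _ do rewrite term_telescopes.
  by rewrite sumrN telescope_sumr // opprB.
have u1 : u 1%N = 1 / fib R p.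
  by rewrite /u expn1 mulnC exprM sqrr_sign.
have u_cvg0 : u N @[N --> \oo] --> 0.
  (* Taking norms removes the alternating sign and leaves the reciprocal of [fib R (p ^ N)]. *)
  apply/norm_cvg0P; apply: cvg_trans (@invf_fib_cvg0 R _ p_gt1 p_odd).
  apply: near_eq_cvg; near=> N; rewrite /u normrM normr_sign mul1r.
  by rewrite ger0_norm // invr_ge0 ltW ?fib_odd_gt0.
rewrite -u1 -[X in _ --> X]subr0.
apply: cvg_trans (cvgB (cvg_cst (u 1%N)) u_cvg0).
by apply: near_eq_cvg; near=> N; rewrite /= partial_sum //; near: N; exists 1%N.
Unshelve. all: by end_near. Qed.
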